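(* In type $A_{n-1}$, the map $(\overline h(j),j)\mapsto X(w_j)=\overline{Bw_jB/B}$, where $w_j\in S_n$ is the longest permutation satisfying $w_j(\overline h(j))=1$ and $w_j(j)=n$, is a bijection from the set of corners of the modified Hessenberg stair shape to the set of irreducible components of $X_H(e_\theta)$.
   Context: Let $G=\mathrm{SL}_n(\mathbb C)$, $n\ge2$, $B$ upper triangular, $T$ diagonal, $W=S_n$ where $w\in S_n$ is represented by the permutation matrix sending $e_i\mapsto e_{w(i)}$; $X(w)=\overline{BwB/B}\subseteq G/B$ is the Schubert variety. A Hessenberg function is a weakly increasing $h:\{1,\dots,n\}\to\{1,\dots,n\}$ with $j\le h(j)$; its Hessenberg subspace is $H=\{(a_{ij})\in\mathfrak{sl}_n: a_{ij}=0\text{ for }i>h(j)\}$. Let $e_\theta=E_{1n}$ and $X_H(e_\theta)=\{gB:\mathrm{Ad}_{g^{-1}}(e_\theta)\in H\}$ (equivalently, the flags $V_\bullet$ with $e_\theta V_j\subseteq V_{h(j)}$ for all $j$). With the convention $h(0):=0$, the modified Hessenberg function is $\overline h(j)=j-1$ if $h(j-1)=j-1$ and $h(j)=j$, and $\overline h(j)=h(j)$ otherwise; set $\overline h(0):=0$. A pair $(i,j)\in\{1,\dots,n\}^2$ is a corner of the modified Hessenberg stair shape if $i=\overline h(j)$ and $\overline h(j-1)<\overline h(j)$ (for a corner one has $\overline h(j)\ne j$). *)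

(* Defs.v *)
From HB Require Import structures.
From mathcomp Require Import all_boot all_order all_fingroup all_algebra.
Set Implicit Arguments. Unset Strict Implicit. Unset Printing Implicit Defensive.
Import Order.TTheory GRing.Theory.
Local Open Scope ring_scope.

(* Conventions: matrices are 'M[F]_n with 0-based indices 'I_n; the paper's
   1-based index k corresponds to the ordinal of value k-1.  Subsets of G/B
   are encoded as right-B-stable subsets of G = SL_n (predicates on
   matrices); the topology on G/B is the quotient topology of the Zariski
   topology of SL_n (a subset of G/B is closed iff its preimage in G is). *)

Inductive polyfun (F : closedFieldType) (n : nat) : ('M[F]_n -> F) -> Prop :=
| pf_const (c : F) : polyfun (fun _ => c)
| pf_coord (i j : 'I_n) : polyfun (fun A => A i j)
| pf_add f g : polyfun f -> polyfun g -> polyfun (fun A => f A + g A)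
| pf_mul f g : polyfun f -> polyfun g -> polyfun (fun A => f A * g A).

Definition inSL (F : closedFieldType) (n : nat) (g : 'M[F]_n) : Prop :=
  \det g = 1.

Definition zclosedSL (F : closedFieldType) (n : nat) (C : 'M[F]_n -> Prop) : Prop :=
  exists S : ('M[F]_n -> F) -> Prop,
    (forall f, S f -> polyfun f) /\
    (forall g, C g <-> (inSL g /\ forall f, S f -> f g = 0)).

Definition upper (F : closedFieldType) (n : nat) (b : 'M[F]_n) : Prop :=
  forall i j : 'I_n, (j < i)%N -> b i j = 0.

Definition borel (F : closedFieldType) (n : nat) (b : 'M[F]_n) : Prop :=
  upper b /\ inSL b.

(* A subset of G/B, encoded as its (right B-stable) preimage in G. *)
Definition GBsubset (F : closedFieldType) (n : nat) (Y : 'M[F]_n -> Prop) : Prop :=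
  (forall g, Y g -> inSL g) /\ (forall g b, Y g -> borel b -> Y (g *m b)).

Definition GBclosed (F : closedFieldType) (n : nat) (C : 'M[F]_n -> Prop) : Prop :=
  GBsubset C /\ zclosedSL C.

Definition subsetP (T : Type) (A B : T -> Prop) : Prop := forall x, A x -> B x.
Definition eqsetP (T : Type) (A B : T -> Prop) : Prop := forall x, A x <-> B x.

Definition irreducible (F : closedFieldType) (n : nat) (Y : 'M[F]_n -> Prop) : Prop :=
  (exists g, Y g) /\
  forall C1 C2, GBclosed C1 -> GBclosed C2 ->
    (forall g, Y g -> C1 g \/ C2 g) -> subsetP Y C1 \/ subsetP Y C2.

Definition irr_component (F : closedFieldType) (n : nat) (X Y : 'M[F]_n -> Prop) : Prop :=
  [/\ GBsubset Y, subsetP Y X, irreducible Y &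
      forall Y', GBsubset Y' -> irreducible Y' -> subsetP Y Y' -> subsetP Y' X ->
                 eqsetP Y' Y].

Definition closureGB (F : closedFieldType) (n : nat) (Y : 'M[F]_n -> Prop) : 'M[F]_n -> Prop :=
  fun g => forall C, GBclosed C -> subsetP Y C -> C g.

(* Permutation matrix of w : e_i |-> e_{w(i)} (column i is e_{w i}). *)
Definition pmat (F : closedFieldType) (n : nat) (w : 'S_n) : 'M[F]_n :=
  \matrix_(i, j) (w j == i)%:R.

(* Bruhat cell BwB (preimage in SL_n of BwB/B). *)
Definition bcell (F : closedFieldType) (n : nat) (w : 'S_n) : 'M[F]_n -> Prop :=
  fun g => inSL g /\
    exists b1 b2 : 'M[F]_n, [/\ upper b1, b1 \in unitmx, upper b2, b2 \in unitmx &
                               g = b1 *m @pmat F n w *m b2].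

Definition schubert (F : closedFieldType) (n : nat) (w : 'S_n) : 'M[F]_n -> Prop :=
  closureGB (@bcell F n w).

(* Hessenberg functions h : {1..n} -> {1..n} (values outside are irrelevant). *)
Definition hessenberg_fun (n : nat) (h : nat -> nat) : Prop :=
  (forall j, (1 <= j <= n)%N -> (j <= h j <= n)%N) /\
  (forall i j, (1 <= i)%N -> (i <= j)%N -> (j <= n)%N -> (h i <= h j)%N).

Definition inHess (F : closedFieldType) (n : nat) (h : nat -> nat) (A : 'M[F]_n) : Prop :=
  \tr A = 0 /\ forall i j : 'I_n, (h j.+1 < i.+1)%N -> A i j = 0.

Definition etheta (F : closedFieldType) (n : nat) : 'M[F]_n :=
  \matrix_(i, j) ((val i == 0%N) && (val j == n.-1))%:R.

Definition hessX (F : closedFieldType) (n : nat) (h : nat -> nat) : 'M[F]_n -> Prop :=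
  fun g => inSL g /\ inHess h (invmx g *m @etheta F n *m g).

Definition hz (h : nat -> nat) (j : nat) : nat := if j == 0%N then 0%N else h j.

Definition hbar (h : nat -> nat) (j : nat) : nat :=
  if j == 0%N then 0%N
  else if (hz h j.-1 == j.-1) && (h j == j) then j.-1 else h j.

(* (hbar j, j) is a corner of the modified stair shape, with (hbar j, j) in {1..n}^2. *)
Definition corner (n : nat) (h : nat -> nat) (j : nat) : Prop :=
  [/\ (1 <= j <= n)%N, (1 <= hbar h j <= n)%N & (hbar h j.-1 < hbar h j)%N].

Definition perm_length (n : nat) (w : 'S_n) : nat :=
  #|[set p : 'I_n * 'I_n | (p.1 < p.2)%N && (w p.2 < w p.1)%N]|.

Definition perm_constr (n : nat) (a b : nat) (w : 'S_n) : Prop :=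
  (forall i : 'I_n, i.+1 = a -> val (w i) = 0%N) /\
  (forall i : 'I_n, i.+1 = b -> (val (w i)).+1 = n).

Definition longest_with (n : nat) (a b : nat) (w : 'S_n) : Prop :=
  perm_constr a b w /\ forall w' : 'S_n, perm_constr a b w' -> (perm_length w' <= perm_length w)%N.

(* Main.v *)
Require Import Defs.
From HB Require Import structures.
From mathcomp Require Import all_boot all_order all_fingroup all_algebra.
From mathcomp Require Import ring zify.
From Stdlib Require Import Classical.
Set Implicit Arguments.
Unset Strict Implicit.
Unset Printing Implicit Defensive.
Import Order.TTheory GRing.Theory.
Local Open Scope ring_scope.

(* By the Bruhat decomposition, whether a flag gB lies in the variety depends only
   on its cell BvB/B: the matrix g^-1 E_1n g is the product of the first column
   of g^-1 and the last row of g, the lowest nonzero entry of the former is in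
   position v^-1(1) and the leftmost nonzero entry of the latter in position
   v^-1(n), so the condition is v^-1(1) <= h(v^-1(n)).  The conditions
   v^-1(1) <= a, v^-1(n) >= b with a <> b define a closed subset, and it is the
   Schubert variety of the longest w with w(a) = 1, w(b) = n, because every v
   satisfying them reaches w by swaps v(i) < v(j), i < j, which enlarge the cell
   closure.  The variety is thus the union of these sets over the corners, and no
   one of them contains another.  Irreducibility and closure relations are tested on
   polynomial curves. *)

(** * Upper triangular matrices and their inverses *)

Section UpperTriangular.
Variables (F : closedFieldType) (n : nat).
Implicit Types (b c : 'M[F]_n).

Lemma upper1 : upper (1%:M : 'M[F]_n).
Proof. by move=> i j ltji; rewrite mxE; case: eqP ltji => // ->; rewrite ltnn. Qed.

Lemma upper_mulmx b c : upper b -> upper c -> upper (b *m c).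
Proof.
move=> ub uc i j ltji; rewrite mxE big1 // => k _.
have [ltki|leik] := ltnP k i; first by rewrite ub ?mul0r.
by rewrite uc ?mulr0 // (leq_trans ltji).
Qed.

Lemma det_upper b : upper b -> \det b = \prod_i b i i.
Proof.
move=> ub; rewrite -det_tr det_trig; first by apply: eq_bigr => i _; rewrite mxE.
by apply/is_trig_mxP => i j ltij; rewrite mxE ub.
Qed.

Lemma upper_unit_diag b i : upper b -> b \in unitmx -> b i i != 0.
Proof.
by move=> ub; rewrite unitmxE det_upper // unitfE => /prodf_neq0; apply.
Qed.

(** The lowest nonzero entry below the diagonal in column j of the inverse, say in row k, would
    survive in entry (k, j) of [b *m invmx b], multiplied by the nonzero [b k k]. *)
Lemma upper_invmx b : upper b -> b \in unitmx -> upper (invmx b).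
Proof.
move=> ub bU i j ltji; apply/eqP; apply/negPn/negP => nz.
pose P (k : 'I_n) := (j < k)%N && (invmx b k j != 0).
have Pi : P i by rewrite /P ltji.
case: (@arg_maxnP _ i P val Pi) => k /andP[ltjk nzk] kmax.
have := mulmxV bU => /matrixP/(_ k j).
rewrite !mxE (bigD1 k) //= big1 ?addr0.
  have -> : (k == j) = false by apply/eqP => e; rewrite e ltnn in ltjk.
  by move/eqP; rewrite mulf_eq0 (negPf nzk) (negPf (upper_unit_diag _ ub bU)).
move=> l nlk; have [ltlk|lekl] := ltnP l k; first by rewrite ub ?mul0r.
have ltkl : (k < l)%N by rewrite ltn_neqAle lekl eq_sym andbT.
have [->|nzl] := eqVneq (invmx b l j) 0; first by rewrite mulr0.
have := kmax l; rewrite /P nzl (ltn_trans ltjk ltkl) => /(_ isT).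
by rewrite /= => lelk; move: (leq_ltn_trans lelk ltkl); rewrite ltnn.
Qed.

End UpperTriangular.

(** * Bruhat decomposition of invertible matrices *)

Section Bruhat.
Variable F : closedFieldType.

(** Carries the recursion of the decomposition: by [mul_insert_mx], a factorization of the
    complementary minor lifts factor by factor. *)
Definition insert_mx n (p q : 'I_n.+1) (A : 'M[F]_n) : 'M[F]_n.+1 :=
  \matrix_(i, j) match unlift p i, unlift q j with
                 | Some i', Some j' => A i' j'
                 | None, None => 1
                 | _, _ => 0
                 end.

Lemma mul_insert_mx n (p q r : 'I_n.+1) (A B : 'M[F]_n) :
  insert_mx p q A *m insert_mx q r B = insert_mx p r (A *m B).
Proof.
apply/matrixP => i j; rewrite !mxE (bigD1_ord q) //= !mxE unlift_none.
under eq_bigr => k _ do rewrite !mxE liftK.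
case: (unliftP p i) => [i'|] _; case: (unliftP r j) => [j'|] _ /=;
  rewrite ?mulr0 ?mul0r ?mulr1 ?add0r; last 3 first.
- by rewrite big1 // => k _; rewrite mulr0.
- by rewrite big1 // => k _; rewrite mul0r.
- by rewrite big1 ?addr0 // => k _; rewrite mul0r.
by rewrite mxE.
Qed.

Lemma insert_mx1 n (p : 'I_n.+1) : insert_mx p p 1%:M = 1%:M.
Proof.
apply/matrixP => i j; rewrite !mxE.
case: (unliftP p i) => [i'|] ->; case: (unliftP p j) => [j'|] -> //=.
- by rewrite mxE (inj_eq lift_inj).
- by rewrite eq_sym (negPf (neq_lift _ _)).
- by rewrite (negPf (neq_lift _ _)).
- by rewrite eqxx.
Qed.

Lemma insert_mx_unit n (p : 'I_n.+1) (A : 'M[F]_n) :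
  A \in unitmx -> insert_mx p p A \in unitmx.
Proof.
move=> AU; suff /mulmx1_unit[] : insert_mx p p A *m insert_mx p p (invmx A) = 1%:M by [].
by rewrite mul_insert_mx mulmxV // insert_mx1.
Qed.

(** The rows of the insertion that come from [A] vanish in column q, so deleting row q and column p
    from the large inverse leaves a right inverse of [A]. *)
Lemma insert_mx_unit_inv n (p q : 'I_n.+1) (A : 'M[F]_n) :
  insert_mx p q A \in unitmx -> A \in unitmx.
Proof.
move=> /mulmxV; set X := invmx _ => AX.
suff /mulmx1_unit[] : A *m (\matrix_(i, j) X (lift q i) (lift p j)) = 1%:M by [].
apply/matrixP => i j; have /matrixP/(_ (lift p i) (lift p j)) := AX.
rewrite !mxE (bigD1_ord q) //= !mxE liftK unlift_none mul0r add0r.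
rewrite (inj_eq lift_inj) => <-; apply: eq_bigr => k _.
by rewrite !mxE !liftK.
Qed.

Lemma insert_mx_upper n (p : 'I_n.+1) (A : 'M[F]_n) : upper A -> upper (insert_mx p p A).
Proof.
move=> uA i j; rewrite mxE.
case: (unliftP p i) => [i'|] ->; case: (unliftP p j) => [j'|] -> //=; last by rewrite ltnn.
move=> lt; apply: uA; move: lt; rewrite /= /bump !ltnNge; apply: contraNN => le.
rewrite leq_add //; case: (leqP p i') => // lepi.
by rewrite (leq_trans lepi le).
Qed.

Lemma pmat_lift_perm n (p : 'I_n.+1) (w : 'S_n) :
  @pmat F n.+1 (lift_perm ord0 p w) = insert_mx p ord0 (@pmat F n w).
Proof.
apply/matrixP => i j; rewrite !mxE.
case: (unliftP p i) => [i'|] ->; case: (unliftP ord0 j) => [j'|] -> /=.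
- by rewrite lift_perm_lift (inj_eq lift_inj) mxE.
- by rewrite lift_perm_id (negPf (neq_lift _ _)).
- by rewrite lift_perm_lift eq_sym (negPf (neq_lift _ _)).
- by rewrite lift_perm_id eqxx.
Qed.

Definition bruhat_form n (w : 'S_n) (A : 'M[F]_n) : Prop :=
  exists b1 b2 : 'M[F]_n, [/\ upper b1, b1 \in unitmx, upper b2, b2 \in unitmx &
                               A = b1 *m @pmat F n w *m b2].

(* Clear the first column above its lowest nonzero entry, which sits in row p,
   then row p to the right of it, and recurse on the complementary minor. *)
Lemma bruhat_decomposition n (A : 'M[F]_n) : A \in unitmx -> exists w, bruhat_form w A.
Proof.
elim: n A => [|n IHn] A AU.
  exists 1%g, 1%:M, 1%:M; rewrite unitmx1; split=> //; try exact: upper1.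
  by apply/matrixP => -[].
have [i0 nz0] : exists i, A i ord0 != 0.
  apply/existsP; apply: contraLR AU; rewrite negb_exists => /forallP all0.
  rewrite unitmxE (expand_det_col _ ord0) big1 ?unitr0 // => i _.
  by rewrite (eqP (negPn (all0 i))) mul0r.
case: (@arg_maxnP _ i0 (fun i => A i ord0 != 0) val nz0) => p nzp pmax.
(* With pivot [A p ord0], [b1] carries the first column of [A] in its column p, [b2] carries the
   pivot row divided by the pivot, and [A'] is the Schur complement. *)
pose b1 : 'M[F]_n.+1 := \matrix_(i, j) if j == p then A i ord0 else (i == j)%:R.
pose b2 : 'M[F]_n.+1 := \matrix_(i, j) if i == ord0 then A p j / A p ord0 else (i == j)%:R.
pose A' : 'M[F]_n := \matrix_(i, j) (A (lift p i) (lift ord0 j)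
   - A (lift p i) ord0 * (A p (lift ord0 j) / A p ord0)).
have lift0n k : (lift ord0 k == ord0 :> 'I_n.+1) = false.
  by rewrite eq_sym (negPf (neq_lift _ _)).
have liftpn k : (lift p k == p) = false by rewrite eq_sym (negPf (neq_lift _ _)).
have defA : A = b1 *m insert_mx p ord0 A' *m b2.
  have -> : b1 *m insert_mx p ord0 A' = \matrix_(i, j)
      if unlift ord0 j is Some j' then
        if unlift p i is Some i' then A' i' j' else 0
      else A i ord0.
    apply/matrixP => i j; rewrite !mxE (bigD1_ord p) //= !mxE eqxx unlift_none.
    under eq_bigr => k _ do rewrite !mxE liftK liftpn.
    case: (unliftP ord0 j) => [j'|] _; last first.
      by rewrite mulr1 big1 ?addr0 // => k _; rewrite mulr0.
    rewrite mulr0 add0r; case: (unliftP p i) => [i'|] ->.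
      rewrite (bigD1 i') //= eqxx mul1r big1 ?addr0 // => k nk.
      by rewrite (inj_eq lift_inj) eq_sym (negPf nk) mul0r.
    by rewrite big1 // => k _; rewrite eq_sym liftpn mul0r.
  apply/matrixP => i j; rewrite !mxE (bigD1_ord ord0) //= !mxE eqxx unlift_none.
  under eq_bigr => k _ do rewrite !mxE liftK lift0n.
  case: (unliftP ord0 j) => [j'|] ->; last first.
    rewrite divff // mulr1 big1 ?addr0 // => k _.
    by rewrite lift0n mulr0.
  case: (unliftP p i) => [i'|] ->.
    rewrite (bigD1 j') //= eqxx mulr1 big1 ?addr0 ?mxE.
      by rewrite addrC subrK.
    by move=> k nk; rewrite (inj_eq lift_inj) (negPf nk) mulr0.
  by rewrite mulrC divfK // big1 ?addr0 // => k _; rewrite mul0r.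
have /andP[] : (b1 *m insert_mx p ord0 A' \in unitmx) && (b2 \in unitmx).
  by rewrite -unitmx_mul -defA.
rewrite unitmx_mul => /andP[b1U insU] b2U.
have [w [c1 [c2 [uc1 c1U uc2 c2U defA']]]] := IHn _ (insert_mx_unit_inv insU).
have ub1 : upper b1.
  move=> i j ltji; rewrite mxE; case: eqP => [ejp|_].
    apply/eqP; apply/negPn/negP => nzi; have := pmax _ nzi => /=.
    by rewrite leqNgt -ejp ltji.
  by case: eqP ltji => // ->; rewrite ltnn.
have ub2 : upper b2.
  move=> i j ltji; rewrite mxE; case: eqP ltji => [->//|_].
  by case: eqP => // ->; rewrite ltnn.
exists (lift_perm ord0 p w), (b1 *m insert_mx p p c1), (insert_mx ord0 ord0 c2 *m b2); split.
- exact: upper_mulmx (insert_mx_upper _ _).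
- by rewrite unitmx_mul b1U insert_mx_unit.
- exact: upper_mulmx (insert_mx_upper _ _) _.
- by rewrite unitmx_mul b2U insert_mx_unit.
rewrite {1}defA defA' pmat_lift_perm -(mul_insert_mx p ord0 ord0).
by rewrite -(mul_insert_mx p p ord0) !mulmxA.
Qed.

End Bruhat.

(** * Zariski-closed sets, irreducibility and closures *)

Section ZariskiSL.
Variables (F : closedFieldType) (n : nat).
Implicit Types (C Y : 'M[F]_n -> Prop).

Lemma polyfun_sum I (r : seq I) (f : I -> 'M[F]_n -> F) :
  (forall i, polyfun (f i)) ->
  exists2 g, polyfun g & forall A, g A = \sum_(i <- r) f i A.
Proof.
move=> pf; elim: r => [|i r [g pg gE]].
  by exists (fun=> 0); [exact: pf_const | move=> A; rewrite big_nil].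
by exists (fun A => f i A + g A); [exact: pf_add | move=> A; rewrite big_cons gE].
Qed.

Lemma polyfun_prod I (r : seq I) (f : I -> 'M[F]_n -> F) :
  (forall i, polyfun (f i)) ->
  exists2 g, polyfun g & forall A, g A = \prod_(i <- r) f i A.
Proof.
move=> pf; elim: r => [|i r [g pg gE]].
  by exists (fun=> 1); [exact: pf_const | move=> A; rewrite big_nil].
by exists (fun A => f i A * g A); [exact: pf_mul | move=> A; rewrite big_cons gE].
Qed.

(** Leibniz expansion. It serves for the entries of the inverse, which are cofactors on SL. *)
Lemma polyfun_minor m (p q : 'I_m -> 'I_n) :
  exists2 g, polyfun g & forall A : 'M[F]_n, g A = \det (mxsub p q A).
Proof.
have prodP (s : 'S_m) : exists g : 'M[F]_n -> F,
    polyfun g /\ forall A, g A = (-1) ^+ s * \prod_i mxsub p q A i (s i).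
  have [g pg gE] := @polyfun_prod _ (index_enum 'I_m)
    (fun i A => A (p i) (q (s i))) (fun i => pf_coord F (p i) (q (s i))).
  exists (fun A => (-1) ^+ s * g A); split; first by apply: pf_mul => //; exact: pf_const.
  by move=> A; rewrite gE; congr (_ * _); apply: eq_bigr => i _; rewrite mxE.
have [G GP] := fin_all_exists prodP.
have [g pg gE] := polyfun_sum (index_enum _) (fun s => proj1 (GP s)).
exists g => // A; rewrite gE; apply: eq_bigr => s _.
exact: (proj2 (GP s)).
Qed.

(** The union is cut out by the products of an equation of [C1] with an equation of [C2]. *)
Lemma zclosedSL_or C1 C2 :
  zclosedSL C1 -> zclosedSL C2 -> zclosedSL (fun g => C1 g \/ C2 g).
Proof.
move=> [S1 [pS1 C1E]] [S2 [pS2 C2E]].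
exists (fun f => exists f1 f2, [/\ S1 f1, S2 f2 & f = fun A => f1 A * f2 A]); split.
  by move=> f [f1 [f2 [s1 s2 ->]]]; apply: pf_mul; [exact: pS1 | exact: pS2].
move=> g; split.
  case=> [/C1E[SLg C1g]|/C2E[SLg C2g]]; split=> // f [f1 [f2 [s1 s2 ->]]].
    by rewrite (C1g _ s1) mul0r.
  by rewrite (C2g _ s2) mulr0.
case=> SLg Cg; case: (classic (C1 g)) => [|nC1]; first by left.
right; apply/C2E; split=> // f2 s2; apply: NNPP => nf2.
apply: nC1; apply/C1E; split=> // f1 s1.
have /eqP := Cg (fun A => f1 A * f2 A) (ex_intro _ f1 (ex_intro _ f2 (And3 s1 s2 erefl))).
by rewrite mulf_eq0 => /orP[/eqP//|/eqP/nf2].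
Qed.

Lemma GBclosed_or C1 C2 : GBclosed C1 -> GBclosed C2 -> GBclosed (fun g => C1 g \/ C2 g).
Proof.
move=> [[SL1 st1] cl1] [[SL2 st2] cl2]; split; last exact: zclosedSL_or.
split=> [g [/SL1|/SL2]|g b [Cg|Cg] bB] //; first by left; apply: st1.
by right; apply: st2.
Qed.

Lemma GBclosed_empty : GBclosed (fun _ : 'M[F]_n => False).
Proof.
split; first by [].
exists (fun f => f = fun=> 1); split; first by move=> f ->; exact: pf_const.
by move=> g; split=> // -[_ /(_ _ erefl)/eqP]; rewrite oner_eq0.
Qed.

(** Induction on [N], splitting off the last set from the union of the others, which is closed by
    [clU]. *)
Lemma irreducible_sub_bigcup Y (P : nat -> Prop) (C : nat -> 'M[F]_n -> Prop) N :
  irreducible Y -> (forall k, P k -> GBclosed (C k)) ->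
  (forall g, Y g -> exists k, [/\ (k < N)%N, P k & C k g]) ->
  exists2 k, P k & Defs.subsetP Y (C k).
Proof.
move=> [[y Yy] irrY] clC; pose U M g := exists k, [/\ (k < M)%N, P k & C k g].
have US M g : U M.+1 g <-> (P M /\ C M g) \/ U M g.
  split=> [[k [ltk Pk Ckg]]|[[PM CM]|[k [ltk Pk Ckg]]]]; last 2 first.
  - by exists M.
  - by exists k; split=> //; apply: ltnW.
  move: ltk; rewrite ltnS leq_eqVlt => /orP[/eqP ek|ltk]; last by right; exists k.
  by left; rewrite -ek.
have clU M : exists2 D, GBclosed D & forall g, U M g <-> D g.
  elim: M => [|M [D clD DE]].
    by exists (fun=> False); [exact: GBclosed_empty | move=> g; split=> // -[k []]].
  case: (classic (P M)) => [PM|nPM].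
    exists (fun g => C M g \/ D g); first by apply: GBclosed_or => //; apply: clC.
    by move=> g; rewrite US DE; split=> [[[]|]|[]]; auto.
  by exists D => // g; rewrite US DE; split=> [[[]|]|]; auto.
elim: N => [|N IH] YU; first by have [k []] := YU y Yy.
case: (classic (P N)) => [PN|nPN]; last first.
  by apply: IH => g /YU /US[[]|].
have [D clD DE] := clU N.
case: (irrY (C N) D) => //; first exact: clC.
- by move=> g /YU /US[[_ ?]|/DE]; [left | right].
- by move=> sY; exists N.
by move=> sY; apply: IH => g /sY /DE.
Qed.

Lemma closureGB_GBsubset Y : GBsubset Y -> GBsubset (closureGB Y).
Proof.
move=> [SLY stY]; split=> [g clg|g b clg bB C clC sYC].
  (* SL itself is a closed B-stable set containing [Y], cut out by no equations. *)
  apply: (clg (@inSL F n)) => //; split; first split=> // h b SLh [_ SLb].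
    by rewrite /inSL det_mulmx SLh SLb mulr1.
  by exists (fun=> False); split=> // h; split=> // -[].
by case: (clC) => -[_ st] _; apply: st => //; exact: clg.
Qed.

Lemma sub_closureGB Y : Defs.subsetP Y (closureGB Y).
Proof. by move=> g Yg C _; apply. Qed.

Lemma closureGB_min Y Y' : Defs.subsetP Y (closureGB Y') -> Defs.subsetP (closureGB Y) (closureGB Y').
Proof. by move=> s g clg C clC sC; apply: clg => // h /s; apply. Qed.

Lemma irreducible_closureGB Y : irreducible Y -> irreducible (closureGB Y).
Proof.
move=> [[y Yy] irrY]; split; first by exists y; exact: sub_closureGB.
move=> C1 C2 cl1 cl2 sY; case: (irrY _ _ cl1 cl2).
- by move=> g /sub_closureGB/sY.
- by move=> s; left=> g; apply.
- by move=> s; right=> g; apply.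
Qed.

End ZariskiSL.

(** * Polynomial curves as a test for closed and irreducible sets *)

Section PolynomialCurves.
Variables (F : closedFieldType) (n : nat).
Implicit Types (A : 'M[F]_n.+1) (c : 'M[{poly F}]_n.+1) (C Y : 'M[F]_n.+1 -> Prop).

Definition col0_scaling (d : F) : 'M[F]_n.+1 :=
  diag_mx (\row_j if j == ord0 then d else 1).

Lemma upper_col0_scaling d : upper (col0_scaling d).
Proof. by move=> i j ltji; rewrite !mxE; case: (i =P j) ltji => // ->; rewrite ltnn. Qed.

Lemma det_col0_scaling d : \det (col0_scaling d) = d.
Proof.
rewrite det_diag (bigD1 ord0) //= mxE eqxx big1 ?mulr1 // => i.
by rewrite mxE => /negPf ->.
Qed.

(* The normalization GL_n -> SL_n; on cosets of the Borel subgroups it is the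
   identification of GL_n / B with SL_n / B. *)
Definition normSL A : 'M[F]_n.+1 := A *m col0_scaling (\det A)^-1.

Lemma normSL_id A : \det A = 1 -> normSL A = A.
Proof.
move=> dA; rewrite /normSL dA invr1 -[RHS]mulmx1; congr (_ *m _).
apply/matrixP => i j; rewrite !mxE; congr (_ *+ _).
by case: ifP.
Qed.

Lemma inSL_normSL A : \det A != 0 -> inSL (normSL A).
Proof. by move=> nz; rewrite /inSL det_mulmx det_col0_scaling divff. Qed.

Definition curve_at c (t : F) : 'M[F]_n.+1 := map_mx (horner_eval t) c.

Lemma det_curve_at c t : \det (curve_at c t) = (\det c).[t].
Proof. by rewrite det_map_mx. Qed.

(** Normalizing divides by [\det c], so [f] along the curve is a rational function of t whose
    denominator is a power of [\det c]; [q] is its numerator. *)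
Lemma polyfun_curve c (f : 'M[F]_n.+1 -> F) : polyfun f ->
  exists N (q : {poly F}), forall t, (\det c).[t] != 0 ->
    q.[t] = (\det c).[t] ^+ N * f (normSL (curve_at c t)).
Proof.
elim=> [x|i j|f1 f2 _ [N1 [q1 E1]] _ [N2 [q2 E2]]|f1 f2 _ [N1 [q1 E1]] _ [N2 [q2 E2]]].
- by exists 0, x%:P => t _; rewrite hornerC mul1r.
(* Only the first column is divided by the determinant; in the others the factor [\det c] is put
   into [q] to match the exponent 1. *)
- exists 1%N, (c i j * (if j == ord0 then 1 else \det c)) => t nz.
  rewrite /normSL /col0_scaling mul_mx_diag !mxE det_curve_at hornerM expr1 /horner_eval.
  case: eqP => _; last by rewrite mulr1 mulrC.
  by rewrite hornerC mulr1 mulrCA divff // mulr1.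
- exists (N1 + N2)%N, (q1 * \det c ^+ N2 + q2 * \det c ^+ N1) => t nz.
  rewrite !hornerE E1 // E2 // mulrDr exprD; congr (_ + _).
    by rewrite mulrAC.
  by rewrite mulrC mulrA.
- exists (N1 + N2)%N, (q1 * q2) => t nz.
  by rewrite hornerM E1 // E2 // exprD mulrACA.
Qed.

Lemma poly_neq0_nonroot (p : {poly F}) : p != 0 -> exists t, p.[t] != 0.
Proof. by move/closed_nonrootP => [t]; exists t. Qed.

(** An equation of [C] failing at [t0] has a nonzero numerator [q] along the curve. Then
    [q * s * \det c] has a nonroot, at which the curve lies in [C] and yet violates the equation. *)
Lemma zclosedSL_curve c C (s : {poly F}) t0 : zclosedSL C -> s != 0 ->
  (forall t, s.[t] != 0 -> (\det c).[t] != 0 -> C (normSL (curve_at c t))) ->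
  (\det c).[t0] != 0 -> C (normSL (curve_at c t0)).
Proof.
move=> [S [pS CE]] nzs Cc nz0; apply/CE; split.
  by apply: inSL_normSL; rewrite det_curve_at.
move=> f Sf; have [N [q qE]] := polyfun_curve c (pS _ Sf).
have nzd : \det c != 0 by apply: contraNneq nz0 => ->; rewrite horner0.
apply/eqP; apply: contraT => nzf.
have nzq : q != 0.
  apply: contraNneq nzf => q0; have := qE _ nz0.
  by rewrite q0 horner0 => /esym/eqP; rewrite mulf_eq0 expf_eq0 (negPf nz0) andbF.
have [t] : exists t, (q * s * \det c).[t] != 0.
  by apply: poly_neq0_nonroot; rewrite !mulf_neq0.
rewrite !hornerM !mulf_eq0 !negb_or => /andP[/andP[nq ns] nd].
have /CE[_ /(_ _ Sf) f0] := Cc _ ns nd.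
by rewrite (qE _ nd) f0 mulr0 eqxx in nq.
Qed.

(** Let x lie outside [C1] and y outside [C2]. An equation of [C1] failing at x has a nonzero
    numerator [q] along the curve from x to y; where [q] does not vanish the curve is in [C2], and
    so is y by [zclosedSL_curve]. *)
Lemma irreducible_by_curves Y :
  (exists g, Y g) ->
  (forall x y, Y x -> Y y -> exists c,
     [/\ (\det c).[0] != 0, normSL (curve_at c 0) = x,
         (\det c).[1] != 0, normSL (curve_at c 1) = y &
         forall t, (\det c).[t] != 0 -> Y (normSL (curve_at c t))]) ->
  irreducible Y.
Proof.
move=> neY conn; split=> // C1 C2 [_ cl1] [_ cl2] sY.
apply: NNPP => /not_or_and[n1 n2].
have [x nx] := not_all_ex_not _ _ n1; have [y ny] := not_all_ex_not _ _ n2.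
have [Yx nC1x] := imply_to_and _ _ nx; have [Yy nC2y] := imply_to_and _ _ ny.
have [c [d0 c0 d1 c1 Yc]] := conn x y Yx Yy.
have [S1 [pS1 C1E]] := cl1.
have [f [Sf nf]] : exists f, S1 f /\ f x <> 0.
  apply: NNPP => nex; apply: nC1x; apply/C1E; split.
    by rewrite -c0; apply: inSL_normSL; rewrite det_curve_at.
  by move=> f Sf; apply: NNPP => nf; apply: nex; exists f.
have [N [q qE]] := polyfun_curve c (pS1 _ Sf).
apply: nC2y; rewrite -c1; apply: (@zclosedSL_curve c C2 q) => //.
  apply: contra_not_neq nf => q0; have := qE _ d0.
  rewrite q0 horner0 c0 => /esym/eqP.
  by rewrite mulf_eq0 expf_eq0 (negPf d0) andbF => /eqP.
move=> t nq nd; case: (sY _ (Yc _ nd)) => // /C1E[_ /(_ _ Sf) f0].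
by rewrite (qE _ nd) f0 mulr0 eqxx in nq.
Qed.

End PolynomialCurves.

(** * Longest permutations with prescribed positions of the extreme values *)

Section LongestPermutations.
Variable n : nat.
Implicit Types (v w : 'S_n.+1) (a b i j : 'I_n.+1).

Definition inversions v : {set 'I_n.+1 * 'I_n.+1} :=
  [set p : 'I_n.+1 * 'I_n.+1 | (p.1 < p.2)%N && (v p.2 < v p.1)%N].

Lemma perm_val_card v x : val (v x) = #|[set z | (v z < v x)%N]|.
Proof.
have lt_n : (v x <= n.+1)%N by apply: ltnW.
have -> : #|[set z | (v z < v x)%N]| = #|[set y : 'I_n.+1 | (y < v x)%N]|.
  rewrite -(card_imset _ (@perm_inj _ v)); apply: eq_card => y; rewrite inE.
  apply/imsetP/idP => [[z]|lty]; first by rewrite inE => ? ->.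
  by exists (v^-1 y)%g; rewrite ?inE permKV.
rewrite -sum1_card; under eq_bigl => y do rewrite inE.
by rewrite (big_ord_narrow lt_n) sum_nat_const card_ord muln1.
Qed.

(** The inversions determine the relative order of all values, and [v x] is the number of values
    smaller than it. *)
Lemma inversions_inj : injective inversions.
Proof.
move=> u v /setP invE; apply/permP => x; apply: val_inj; rewrite (perm_val_card u) (perm_val_card v).
have neq_val (w : 'S_n.+1) y z : y != z -> val (w y) != val (w z).
  by rewrite (inj_eq val_inj) (inj_eq perm_inj).
apply: eq_card => z; rewrite !inE.
have [->|nzx] := eqVneq z x; first by rewrite !ltnn.
have ltE (w : 'S_n.+1) : (w z < w x)%N =
    if (z < x)%N then (z, x) \notin inversions w else (x, z) \in inversions w.
  have nv := neq_val w z x nzx; have nzx' : val z != val x by rewrite val_eqE.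
  rewrite !inE /=; move: nv nzx' => /=.
  by case: (ltngtP (w z) (w x)); case: (ltngtP z x).
by rewrite (ltE u) (ltE v) !invE.
Qed.

(** The one-line form of the longest permutation of the theorem, as [longest_arranged] shows. *)
Definition arranged a b v : Prop :=
  [/\ v a = ord0, v b = ord_max &
      forall i j, i \notin [:: a; b] -> j \notin [:: a; b] -> (i < j)%N -> (v j < v i)%N].

Definition pos_constr a b v : Prop := ((v^-1)%g ord0 <= a)%N /\ (b <= (v^-1)%g ord_max)%N.

(** Termination measure for the swaps: undoing an ascent i < j lowers it by (j - i)(v j - v i), as
    in the rearrangement inequality. *)
Definition rearr v : nat := (\sum_(k < n.+1) k * v k)%N.

Lemma rearr_swap v i j : (i < j)%N -> (v i < v j)%N ->
  (rearr (tperm i j * v)%g < rearr v)%N.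
Proof.
move=> ltij ltv; have neq : j != i by apply: contraTneq ltij => ->; rewrite ltnn.
have rearrE (w : 'S_n.+1) :
    rearr w = (i * w i + (j * w j + \sum_(k < n.+1 | (k != i) && (k != j)) k * w k))%N.
  by rewrite /rearr (bigD1 i) //= (bigD1 j).
rewrite !rearrE !permM tpermL tpermR.
under eq_bigr => k /andP[ki kj] do rewrite permM tpermD 1?eq_sym //.
rewrite !addnA ltn_add2r; move: ltij ltv.
move: (val i) (val j) (val (v i)) (val (v j)) => /= x y z t; nia.
Qed.

(** First the minimum, at p, is moved right to a, then the maximum, at q, left to b; afterwards any
    ascent avoiding a and b can be swapped. Each move exchanges an ascent. *)
Lemma pos_constr_swap a b v : a != b -> pos_constr a b v ->
  arranged a b v \/
  exists i j, [/\ (i < j)%N, (v i < v j)%N & pos_constr a b (tperm i j * v)%g].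
Proof.
move=> nab; have neq_val (x y : 'I_n.+1) : (val x == val y) = (x == y) by exact: val_eqE.
have n_gt0 : (0 < n)%N.
  by case: n a b nab => // x y; rewrite (ord1 x) (ord1 y) eqxx.
rewrite /pos_constr; set p := (v^-1)%g ord0; set q := (v^-1)%g ord_max => -[lepa lebq].
have vp : v p = ord0 by rewrite permKV.
have vq : v q = ord_max by rewrite permKV.
have npq : p != q by apply: contraTneq n_gt0 => e; move: vp; rewrite e vq => -[->].
have swapV i j x : (((tperm i j * v)^-1)%g x = tperm i j ((v^-1)%g x)).
  by rewrite invMg permM tpermV.
have vpos x : x != p -> (0 < v x)%N.
  by rewrite lt0n -(inj_eq (@perm_inj _ v)) vp -val_eqE.
have vmax x : x != q -> (v x < n)%N.
  rewrite -(inj_eq (@perm_inj _ v)) vq -val_eqE /= => nx.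
  by rewrite ltn_neqAle nx -ltnS ltn_ord.
have [epa|npa] := eqVneq p a; last first.
  have ltpa : (p < a)%N by rewrite ltn_neqAle neq_val npa.
  have [eqa|nqa] := eqVneq q a; last first.
    right; exists p, a; rewrite !swapV -/p -/q tpermL tpermD // 1?eq_sym //.
    by rewrite vp vpos // eq_sym.
  (* The maximum sits at a, so swapping p and a would send it to p, which is allowed only if b <= p.
     Otherwise the minimum goes to b, and b <= q = a. *)
  have [lebp|ltpb] := leqP b p.
    right; exists p, a; rewrite !swapV -/p -/q eqa tpermL tpermR.
    by rewrite vp vpos // eq_sym.
  have npb : p != b by apply: contraTneq ltpb => ->; rewrite ltnn.
  right; exists p, b; rewrite !swapV -/p -/q eqa tpermL tpermD // 1?eq_sym //.
  by rewrite vp vpos 1?eq_sym // -eqa lebq.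
have [eqb|nqb] := eqVneq q b; last first.
  have ltbq : (b < q)%N by rewrite ltn_neqAle neq_val eq_sym nqb.
  right; exists b, q; rewrite !swapV -/p -/q tpermR tpermD ?epa // 1?eq_sym //.
    by rewrite vq vmax 1?eq_sym // leqnn.
  by rewrite -epa.
case: (boolP [exists i, exists j, [&& i \notin [:: a; b], j \notin [:: a; b],
                                    (i < j)%N & (v i < v j)%N]]).
  move=> /existsP[i /existsP[j /and4P[ni nj ltij ltv]]]; right; exists i, j.
  move: ni nj; rewrite !inE !negb_or => /andP[nia nib] /andP[nja njb].
  by rewrite !swapV -/p -/q epa eqb !tpermD // !leqnn.
move=> /existsPn none; left; split; rewrite -?epa -?eqb // => i j ni nj ltij.
have /existsPn/(_ j) := none i; rewrite -epa -eqb ni nj ltij /= -leqNgt leq_eqVlt.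
case/orP=> // /eqP/val_inj/perm_inj e; by rewrite e ltnn in ltij.
Qed.

(** Used twice: to produce an arranged permutation, and to climb through cell closures in
    [schubert_longest]. *)
Lemma pos_constr_ind a b (P : 'S_n.+1 -> Prop) : a != b ->
  (forall v, arranged a b v -> P v) ->
  (forall v i j, (i < j)%N -> (v i < v j)%N -> P (tperm i j * v)%g -> P v) ->
  forall v, pos_constr a b v -> P v.
Proof.
move=> nab Parr Pswap v; have [m] := ubnP (rearr v).
elim: m v => // m IH v ltm cv; case: (pos_constr_swap nab cv) => [/Parr//|].
move=> [i [j [ltij ltv cv']]]; apply: (Pswap v i j ltij ltv); apply: IH cv'.
by rewrite -ltnS (leq_trans _ ltm) // ltnS rearr_swap.
Qed.

(** Inversions involving a or b are the same for all permutations with these two values, and [w]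
    inverts every other pair. *)
Lemma sub_inversions_arranged a b v w :
  arranged a b w -> v a = ord0 -> v b = ord_max -> inversions v \subset inversions w.
Proof.
move=> [wa wb wdec] va vb; apply/subsetP => -[i j]; rewrite !inE /= => /andP[ltij ltv].
rewrite ltij /=; have nij : i != j by apply: contraTneq ltij => ->; rewrite ltnn.
have wneq : val (w i) != val (w j) by rewrite (inj_eq val_inj) (inj_eq perm_inj).
have [ia|nia] := eqVneq i a; first by rewrite ia va in ltv.
have [ib|nib] := eqVneq i b.
  by rewrite ltn_neqAle eq_sym wneq ib wb -ltnS ltn_ord.
have [ja|nja] := eqVneq j a.
  by rewrite ltn_neqAle eq_sym wneq ja wa.
have [jb|njb] := eqVneq j b.
  by move: ltv; rewrite jb vb ltnNge -ltnS ltn_ord.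
by apply: wdec; rewrite // !inE negb_or ?nia ?nja.
Qed.

Lemma arranged_pos_constr a b v : v a = ord0 -> v b = ord_max -> pos_constr a b v.
Proof. by move=> va vb; rewrite /pos_constr -va -vb !permK. Qed.

Lemma arranged_uniq a b v w : arranged a b v -> arranged a b w -> v = w.
Proof.
move=> av aw; case: (av) => va vb _; case: (aw) => wa wb _.
apply: inversions_inj; apply/eqP.
by rewrite eqEsubset (sub_inversions_arranged aw) // (sub_inversions_arranged av).
Qed.

(** An arranged [u] exists, by induction from [w] itself. Its inversions contain those of [w], and
    maximality of the length of [w] makes the two sets equal. *)
Lemma longest_arranged a b w : a != b -> longest_with a.+1 b.+1 w -> arranged a b w.
Proof.
move=> nab [[wa wb] wmax].
have {}wa : w a = ord0 by apply: val_inj; rewrite wa.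
have {}wb : w b = ord_max by apply: val_inj; have [] := wb b erefl.
have [u au] : exists u, arranged a b u.
  by apply: (pos_constr_ind nab _ _ (arranged_pos_constr wa wb)) => // u; exists u.
case: (au) => ua ub _.
suff -> : w = u by [].
apply: inversions_inj; apply/eqP; rewrite eqEcard (sub_inversions_arranged au) //=.
apply: wmax; split=> i [] /val_inj ->; first by rewrite ua.
by rewrite ub.
Qed.

End LongestPermutations.

(** * Permutation matrices and the passage between cells by a swap *)

Section SchubertCells.
Variables (F : closedFieldType) (n : nat).
Implicit Types (v w : 'S_n.+1) (a b i j : 'I_n.+1) (g A : 'M[F]_n.+1).
Local Notation pmatF := (@pmat F n.+1).

(** [perm_mx s] has the 1 of row i in column [s i], whereas [pmat] has the 1 of column j in row
    [v j]; hence the inverse. *)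
Lemma pmatE v : pmatF v = perm_mx v^-1.
Proof. by apply/matrixP => i j; rewrite !mxE -(inj_eq (@perm_inj _ v^-1)%g) permK eq_sym. Qed.

Lemma pmat_unit v : pmatF v \in unitmx.
Proof. by rewrite pmatE unitmx_perm. Qed.

Lemma pmat_swap v i j : pmatF (tperm i j * v)%g = pmatF v *m pmatF (tperm i j).
Proof. by rewrite !pmatE -perm_mxM invMg. Qed.

Lemma mul_pmat_delta v i j : pmatF v *m delta_mx i j = delta_mx (v i) j.
Proof.
apply/matrixP => k l; rewrite !mxE (bigD1 i) //= big1 ?addr0 => [|x nxi].
  by rewrite !mxE eqxx eq_sym; case: eqP => _; rewrite ?mul1r ?mul0r.
by rewrite !mxE (negPf nxi) mulr0.
Qed.

Lemma mul_delta_pmat v i j : delta_mx i (v j) *m pmatF v = delta_mx i j.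
Proof.
apply/matrixP => k l; rewrite !mxE (bigD1 (v j)) //= big1 ?addr0 => [|x nx].
  rewrite !mxE eqxx (inj_eq perm_inj) andbT.
  by do 2!case: eqP => _; rewrite ?mul1r ?mul0r.
by rewrite !mxE (negPf nx) andbF mul0r.
Qed.

Lemma pmat_tperm i j : i != j ->
  pmatF (tperm i j) = 1%:M - delta_mx i i - delta_mx j j + delta_mx i j + delta_mx j i.
Proof.
move=> nij; apply/matrixP => k l; rewrite !mxE.
case: tpermP => [->|->|/eqP nli /eqP nlj].
- rewrite eqxx (negPf nij) !andbF !andbT addr0 subr0 subrr add0r.
  by rewrite eq_sym.
- rewrite eqxx [j == i]eq_sym (negPf nij) !andbF !andbT addr0 subr0 subrr add0r.
  by rewrite eq_sym.
by rewrite (negPf nli) (negPf nlj) !andbF !subr0 !addr0 eq_sym.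
Qed.

(* The identity [1 0; t 1] = [1 1/t; 0 1] [0 1; 1 0] [t 1; 0 -1/t] in the
   rows and columns i, j. *)
Lemma bruhat_form_lower v i j (t : F) : (i < j)%N -> (v i < v j)%N -> t != 0 ->
  bruhat_form (tperm i j * v)%g (pmatF v *m (1%:M + t *: delta_mx j i)).
Proof.
move=> ltij ltv nzt; have nij : i != j by apply: contraTneq ltij => ->; rewrite ltnn.
have nji : j != i by rewrite eq_sym.
(* This is the left factor of the 2 by 2 identity conjugated by [pmatF v]; it is upper because v i <
   v j. *)
pose b1 : 'M[F]_n.+1 := 1%:M + t^-1 *: delta_mx (v i) (v j).
pose b2 : 'M[F]_n.+1 := 1%:M - delta_mx i i - delta_mx j j
  + t *: delta_mx i i + delta_mx i j - t^-1 *: delta_mx j j.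
have eq12 : pmatF v *m (1%:M + t *: delta_mx j i) = b1 *m pmatF (tperm i j * v)%g *m b2.
  have -> : b1 *m pmatF (tperm i j * v)%g = pmatF v *m (1%:M + t^-1 *: delta_mx i j) *m pmatF (tperm i j).
    rewrite pmat_swap mulmxA; congr (_ *m _).
    by rewrite mulmxDr mulmxDl mulmx1 mul1mx -scalemxAl -scalemxAr mul_pmat_delta mul_delta_pmat.
  rewrite -!mulmxA; congr (_ *m _).
  have -> : pmatF (tperm i j) *m b2 = 1%:M - delta_mx i i + t *: delta_mx j i - t^-1 *: delta_mx i j.
    rewrite /b2 !(mulmxDr, mulmxN, mulmx1) -!scalemxAr !mul_pmat_delta tpermL tpermR.
    rewrite pmat_tperm //; apply/matrixP => k l; rewrite !mxE; ring.
  rewrite !(mulmxDr, mulmxDl, mulmxN, mulmx1, mul1mx) -!scalemxAl -!scalemxAr.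
  rewrite !(mul_delta_mx, mul_delta_mx_0) // ?scaler0 scalerA mulVf // scale1r.
  by apply/matrixP => k l; rewrite !mxE; ring.
have : b1 *m pmatF (tperm i j * v)%g *m b2 \in unitmx.
  rewrite -eq12 unitmx_mul pmat_unit /=.
  suff /mulmx1_unit[] : (1%:M + t *: delta_mx j i) *m (1%:M - t *: delta_mx j i) = 1%:M :> 'M[F]_n.+1 by [].
  rewrite mulmxBr mulmx1 mulmxDl mul1mx -scalemxAl -scalemxAr mul_delta_mx_0 //.
  by rewrite !scaler0 addr0 addrK.
rewrite !unitmx_mul => /andP[/andP[b1U _] b2U]; exists b1, b2; split=> //.
- move=> k l ltlk; rewrite !mxE.
  case: (k =P l) ltlk => [->|_ ltlk]; first by rewrite ltnn.
  case: andP => [[/eqP ek /eqP el]|_]; last by rewrite mulr0 addr0.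
  by move: ltlk; rewrite ek el => /(ltn_trans ltv); rewrite ltnn.
- move=> k l ltlk; rewrite !mxE.
  have nkl : (k == l) = false by apply: contraTF ltlk => /eqP ->; rewrite ltnn.
  have aux x : (k == x) && (l == x) = false.
    by apply: contraFF nkl => /andP[/eqP -> /eqP ->].
  rewrite !aux nkl !mulr0 !subr0 !add0r.
  case: andP => [[/eqP ek /eqP el]|_ //].
  by move: ltlk; rewrite ek el => /(ltn_trans ltij); rewrite ltnn.
Qed.

End SchubertCells.

(** * Schubert varieties: irreducibility, closure relations and flag conditions *)

Section SchubertVarieties.
Variables (F : closedFieldType) (n : nat).
Implicit Types (v w : 'S_n.+1) (a b i j : 'I_n.+1) (g A : 'M[F]_n.+1).
Local Notation pmatF := (@pmat F n.+1).

Lemma bruhat_form_unit v A : bruhat_form v A -> A \in unitmx.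
Proof. by move=> [b1 [b2 [_ U1 _ U2 ->]]]; rewrite !unitmx_mul U1 U2 pmat_unit. Qed.

Lemma bruhat_form_mul v A c1 c2 : bruhat_form v A -> upper c1 -> c1 \in unitmx ->
  upper c2 -> c2 \in unitmx -> bruhat_form v (c1 *m A *m c2).
Proof.
move=> [b1 [b2 [u1 U1 u2 U2 ->]]] uc1 Uc1 uc2 Uc2.
exists (c1 *m b1), (b2 *m c2); rewrite !unitmx_mul U1 U2 Uc1 Uc2 !mulmxA.
by split=> //; exact: upper_mulmx.
Qed.

Lemma bcell_normSL v A : bruhat_form v A -> bcell v (normSL A).
Proof.
move=> bA; have := bruhat_form_unit bA; rewrite unitmxE unitfE => dA.
split; first exact: inSL_normSL.
rewrite -[normSL A]mul1mx mulmxA; apply: bruhat_form_mul => //; rewrite ?unitmx1 //.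
- exact: upper1.
- exact: upper_col0_scaling.
by rewrite unitmxE det_col0_scaling unitfE invr_neq0.
Qed.

Lemma bcell_pmat v : bcell v (normSL (pmatF v)).
Proof.
apply: bcell_normSL; exists 1%:M, 1%:M; rewrite unitmx1 mulmx1 mul1mx.
by split=> //; exact: upper1.
Qed.

Lemma bcell_GBsubset v : GBsubset (@bcell F n.+1 v).
Proof.
split=> [g []//|g b [SLg bg] [ub SLb]]; split.
  by rewrite /inSL det_mulmx SLg SLb mulr1.
rewrite -[g]mul1mx; apply: bruhat_form_mul => //; rewrite ?unitmx1 //.
- exact: upper1.
by rewrite unitmxE SLb unitr1.
Qed.

Definition segment A A' : 'M[{poly F}]_n.+1 :=
  (1 - 'X) *: map_mx polyC A + 'X *: map_mx polyC A'.

Lemma segment_at A A' t : curve_at (segment A A') t = (1 - t) *: A + t *: A'.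
Proof. by apply/matrixP => i j; rewrite !mxE /horner_eval !hornerE. Qed.

Lemma const_at A t : curve_at (map_mx polyC A) t = A.
Proof. by apply/matrixP => i j; rewrite !mxE /horner_eval hornerC. Qed.

Lemma curve_atM c c' t : curve_at (c *m c') t = curve_at c t *m curve_at c' t :> 'M[F]_n.+1.
Proof. by rewrite /curve_at map_mxM. Qed.

(** Two points of the cell are joined by moving both triangular factors along straight segments;
    wherever the product is invertible so are the factors, and the curve stays in the cell. *)
Lemma irreducible_bcell v : irreducible (@bcell F n.+1 v).
Proof.
apply: irreducible_by_curves; first by exists (normSL (pmatF v)); exact: bcell_pmat.
move=> x y [SLx [b1 [b2 [u1 U1 u2 U2 xE]]]] [SLy [c1 [c2 [uc1 Uc1 uc2 Uc2 yE]]]].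
pose c := segment b1 c1 *m map_mx polyC (pmatF v) *m segment b2 c2.
have cE t : curve_at c t =
    ((1 - t) *: b1 + t *: c1) *m pmatF v *m ((1 - t) *: b2 + t *: c2).
  by rewrite !curve_atM !segment_at const_at.
have c0 : curve_at c 0 = x by rewrite cE subr0 !scale1r !scale0r !addr0 -xE.
have c1E : curve_at c 1 = y by rewrite cE subrr !scale1r !scale0r !add0r -yE.
exists c; rewrite -!det_curve_at c0 c1E SLx SLy oner_eq0 !normSL_id //; split=> // t.
rewrite -det_curve_at => nz; apply: bcell_normSL.
have : curve_at c t \in unitmx by rewrite unitmxE unitfE.
have upper_comb (A A' : 'M[F]_n.+1) : upper A -> upper A' -> upper ((1 - t) *: A + t *: A').
  by move=> uA uA' i j ltji; rewrite !mxE uA // uA' // !mulr0 addr0.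
rewrite cE !unitmx_mul => /andP[/andP[Ul _] Ur].
by do 2!eexists; split; last reflexivity; rewrite ?Ul ?Ur //; exact: upper_comb.
Qed.

Lemma irreducible_schubert v : irreducible (@schubert F n.+1 v).
Proof. exact/irreducible_closureGB/irreducible_bcell. Qed.

(** The point is the value at t = 0 of a curve which, by [bruhat_form_lower], lies in the cell of
    the swapped permutation for t nonzero. *)
Lemma bcell_sub_schubert_swap v i j : (i < j)%N -> (v i < v j)%N ->
  Defs.subsetP (@bcell F n.+1 v) (schubert (tperm i j * v)%g).
Proof.
move=> ltij ltv g [SLg [b1 [b2 [u1 U1 u2 U2 gE]]]] C [_ clC] sC.
pose c := map_mx polyC (b1 *m pmatF v) *m (1%:M + 'X *: delta_mx j i) *m map_mx polyC b2.
have cE t : curve_at c t = b1 *m (pmatF v *m (1%:M + t *: delta_mx j i)) *m b2.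
  rewrite !curve_atM !const_at mulmxA; congr (_ *m _ *m _).
  by apply/matrixP => k l; rewrite !mxE /horner_eval !hornerE !hornerMn !hornerE.
have c0 : curve_at c 0 = g by rewrite cE scale0r addr0 mulmx1 -gE.
rewrite -[g]normSL_id // -c0; apply: (@zclosedSL_curve _ _ c C 'X); rewrite ?polyX_eq0 //.
  move=> t; rewrite hornerX => nzt _; apply: sC; apply: bcell_normSL; rewrite cE.
  by apply: bruhat_form_mul => //; exact: bruhat_form_lower.
by rewrite -det_curve_at c0 SLg oner_eq0.
Qed.

(* In terms of flags: e_1 lies in V_a (a counted from 1), and V_j lies in the
   hyperplane x_n = 0 for every j < b. *)
Definition flag_constr a b : 'M[F]_n.+1 -> Prop := fun g =>
  [/\ inSL g, forall i, (a < i)%N -> invmx g i ord0 = 0 &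
      forall j, (j < b)%N -> g ord_max j = 0].

(** The last row of [b1] is zero off the diagonal, so the last row of [g] is a multiple of a single
    row of [b2]. *)
Lemma bruhat_last_row v (b1 b2 : 'M[F]_n.+1) g j : upper b1 -> g = b1 *m pmatF v *m b2 ->
  g ord_max j = b1 ord_max ord_max * b2 ((v^-1)%g ord_max) j.
Proof.
move=> u1 ->; rewrite -mulmxA pmatE -row_permE mxE (bigD1 ord_max) //= big1 ?addr0.
  by rewrite mxE.
move=> k nk; rewrite u1 ?mul0r // ltn_neqAle -ltnS ltn_ord andbT.
by move: nk; rewrite -val_eqE.
Qed.

Lemma bruhat_inv_col0 v (b1 b2 : 'M[F]_n.+1) g i : upper b1 -> b1 \in unitmx -> b2 \in unitmx ->
  g = b1 *m pmatF v *m b2 ->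
  invmx g i ord0 = invmx b2 i ((v^-1)%g ord0) * invmx b1 ord0 ord0.
Proof.
move=> u1 U1 U2 gE.
have -> : invmx g = invmx b2 *m perm_mx v *m invmx b1.
  have gU : g \in unitmx by rewrite gE !unitmx_mul U1 U2 pmat_unit.
  apply: (can_inj (mulKmx gU)); rewrite mulmxV // gE pmatE !mulmxA mulmxK //.
  by rewrite -(mulmxA b1) -perm_mxM mulVg perm_mx1 mulmx1 mulmxV.
rewrite -{1}[v]invgK -col_permE mxE (bigD1 ord0) //= big1 ?addr0; first by rewrite mxE.
move=> k nk; rewrite (upper_invmx u1 U1) ?mulr0 // lt0n.
by move: nk; rewrite -val_eqE.
Qed.

Lemma bcell_inv_col0 v g : bcell v g ->
  invmx g ((v^-1)%g ord0) ord0 != 0 /\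
  forall i, ((v^-1)%g ord0 < i)%N -> invmx g i ord0 = 0.
Proof.
move=> [_ [b1 [b2 [u1 U1 u2 U2 gE]]]].
have E i := bruhat_inv_col0 i u1 U1 U2 gE; split=> [|i lti]; rewrite E.
  by rewrite mulf_neq0 // upper_unit_diag ?unitmx_inv //; exact: upper_invmx.
by rewrite (upper_invmx u2 U2) // mul0r.
Qed.

Lemma bcell_last_row v g : bcell v g ->
  g ord_max ((v^-1)%g ord_max) != 0 /\
  forall j, (j < (v^-1)%g ord_max)%N -> g ord_max j = 0.
Proof.
move=> [_ [b1 [b2 [u1 U1 u2 U2 gE]]]].
have E j := bruhat_last_row j u1 gE; split=> [|j ltj]; rewrite E.
  by rewrite mulf_neq0 // upper_unit_diag.
by rewrite u2 ?mulr0.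
Qed.

Lemma flag_constr_bcell a b v g : bcell v g -> flag_constr a b g <-> pos_constr a b v.
Proof.
move=> cg; have [nz0 z0] := bcell_inv_col0 cg; have [nz1 z1] := bcell_last_row cg.
split=> [[_ c0 c1]|[lea leb]].
  split; rewrite leqNgt; first by apply: contra_neqN nz0; exact: c0.
  by apply: contra_neqN nz1; exact: c1.
split=> [|i lti|j ltj]; first by case: cg.
  by apply: z0; exact: leq_ltn_trans lti.
by apply: z1; exact: leq_trans leb.
Qed.

Lemma inSL_bcell g : inSL g -> exists v, bcell v g.
Proof.
move=> SLg; have [|v bv] := @bruhat_decomposition F n.+1 g.
  by rewrite unitmxE SLg unitr1.
by exists v; split.
Qed.

(** B-stability holds because membership depends only on the cell; on SL the entries of the inverse
    are cofactors, so the conditions are polynomial. *)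
Lemma flag_constr_closed a b : GBclosed (flag_constr a b).
Proof.
split; first split=> [g []//|g c fg Bc].
  have [v cg] : exists v, bcell v g by apply: inSL_bcell; case: fg.
  apply/(@flag_constr_bcell _ _ v); last exact/(flag_constr_bcell _ _ cg).
  exact: (proj2 (bcell_GBsubset v)).
have adjP i : exists f, polyfun f /\ forall A : 'M[F]_n.+1, f A = \adj A i ord0.
  have [f pf fE] := @polyfun_minor F n.+1 n (lift ord0) (lift i).
  exists (fun A => (-1) ^+ (@ord0 n + i) * f A); split.
    by apply: pf_mul => //; exact: pf_const.
  move=> A; rewrite fE mxE /cofactor; congr (_ * \det _).
  by apply/matrixP => k l; rewrite !mxE.
have [f fP] := fin_all_exists adjP.
exists (fun p => (exists2 i : 'I_n.+1, (a < i)%N & p = f i) \/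
                 (exists2 j : 'I_n.+1, (j < b)%N & p = fun A => A ord_max j)); split.
  move=> p [[i _ ->]|[j _ ->]]; last exact: pf_coord.
  exact: (proj1 (fP i)).
have invE g i : inSL g -> invmx g i ord0 = f i g.
  by move=> SLg; rewrite (proj2 (fP i)) /invmx unitmxE SLg unitr1 invr1 scale1r.
move=> g; split=> [[SLg c0 c1]|[SLg z]].
  split=> // p [[i lti ->]|[j ltj ->]]; last exact: c1.
  by rewrite -invE // c0.
split=> // [i lti|j ltj]; last by apply: (z (fun A => A ord_max j)); right; exists j.
by rewrite invE // z //; left; exists i.
Qed.

(** The flag conditions are closed and hold on the cell of [w]. Conversely [pos_constr_ind] leads
    from any cell satisfying them to that of [w] through growing closures. *)
Lemma schubert_longest a b w : a != b -> longest_with a.+1 b.+1 w ->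
  eqsetP (@schubert F n.+1 w) (flag_constr a b).
Proof.
move=> nab lw; have aw := longest_arranged nab lw; have [wa wb _] := aw.
move=> g; split.
  apply; first exact: flag_constr_closed.
  by move=> h ch; apply/(flag_constr_bcell _ _ ch); exact: arranged_pos_constr.
move=> fg; have [v cg] : exists v, bcell v g by apply: inSL_bcell; case: fg.
have cv : pos_constr a b v by apply/(flag_constr_bcell _ _ cg).
move: v cv g cg {fg}; apply: (pos_constr_ind nab).
  by move=> v av g; rewrite (arranged_uniq av aw); exact: sub_closureGB.
move=> v i j ltij ltv IH g /(bcell_sub_schubert_swap ltij ltv).
exact: closureGB_min.
Qed.

(** The inclusion is tested at the torus-fixed point of [w], whose extreme values sit exactly at a
    and b. *)
Lemma flag_constr_sub a b a' b' : a != b ->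
  (exists w, longest_with a.+1 b.+1 w) ->
  Defs.subsetP (flag_constr a b) (flag_constr a' b') -> (a <= a')%N /\ (b' <= b)%N.
Proof.
move=> nab [w lw] s; have [wa wb _] := longest_arranged nab lw.
have cw := bcell_pmat w.
have /s/(flag_constr_bcell _ _ cw) : flag_constr a b (normSL (pmatF w)).
  by apply/(flag_constr_bcell _ _ cw); exact: arranged_pos_constr.
by rewrite /pos_constr -wa -wb !permK.
Qed.

End SchubertVarieties.

(** * The Hessenberg variety as a union over corners *)

Section HessenbergVariety.
Variables (F : closedFieldType) (n : nat) (h : nat -> nat).
Hypothesis hH : hessenberg_fun n.+1 h.

(** The conjugate has rank one, is nonzero at (p, q) and vanishes unless i <= p and q <= j; as [h]
    is increasing, only the entry (p, q) can violate the condition. *)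
Lemma hessX_bcell (v : 'S_n.+1) (g : 'M[F]_n.+1) : (0 < n)%N -> bcell v g ->
  hessX h g <-> (((v^-1)%g ord0).+1 <= h ((v^-1)%g ord_max).+1)%N.
Proof.
move=> n_gt0 cg; have [nz0 z0] := bcell_inv_col0 cg; have [nz1 z1] := bcell_last_row cg.
set p := (v^-1)%g ord0 in nz0 z0 *; set q := (v^-1)%g ord_max in nz1 z1 *.
have SLg : inSL g by case: cg.
have gU : g \in unitmx by rewrite unitmxE SLg unitr1.
have thE : etheta F n.+1 = delta_mx ord0 ord_max by apply/matrixP => i j; rewrite !mxE.
have E i j : (invmx g *m etheta F n.+1 *m g) i j = invmx g i ord0 * g ord_max j.
  by rewrite thE -(mul_delta_mx (ord0 : 'I_1)) mulmxA -colE -mulmxA -rowE mxE big_ord1 !mxE.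
split=> [[_ [_ /(_ p q)]]|le_pq].
  rewrite E => z; rewrite leqNgt; apply/negP => lt; move/eqP: (z lt).
  by rewrite mulf_eq0 (negPf nz0) (negPf nz1).
split=> //; split.
  (* The trace is that of E_1n, which is off the diagonal since n is positive here. *)
  rewrite mxtrace_mulC mulmxA mulmxV // mul1mx thE /mxtrace big1 // => i _; rewrite mxE.
  by case: andP => // -[/eqP-> /eqP[e]]; move: n_gt0; rewrite -e.
move=> i j ltij; rewrite E.
have [leip|/z0->] := leqP i p; last by rewrite mul0r.
have [leqj|/z1->] := leqP q j; last by rewrite mulr0.
have [_ hmon] := hH; have := hmon q.+1 j.+1 isT leqj (ltn_ord j).
lia.
Qed.

Lemma hbar_mono i j : (i <= j <= n.+1)%N -> (hbar h i <= hbar h j)%N.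
Proof.
have step k : (k < n.+1)%N -> (hbar h k <= hbar h k.+1)%N.
  move=> ltk; have [hb hm] := hH; rewrite /hbar /hz /=.
  have := hb k.+1; have := hb k; have := hm k k.+1.
  case: k ltk => [|k] ltk /=; first lia.
  by do ?case: ifP; lia.
move=> /andP[]; elim: j => [|j IH]; first by rewrite leqn0 => /eqP ->.
rewrite leq_eqVlt => /orP[/eqP->//|leij] ltj.
by apply: leq_trans (step _ ltj); apply: IH => //; apply: ltnW.
Qed.

(** If [hbar h j] were j > 1, then h(j-1) would differ from j-1, hence equal j, and there would be
    no jump at j. For j = 1 the convention at 0 gives [hbar h 1 = 0] as soon as h(1) = 1. *)
Lemma corner_neq j : corner n.+1 h j -> hbar h j != j.
Proof.
move=> [/andP[j1 jn] _ lt]; have [hb hm] := hH; move: lt; rewrite /hbar /hz.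
have := hb j; have := hb j.-1; have := hm j.-1 j.
case: j j1 jn => [//|[|j]] _ jn /=; first by case: ifP; lia.
by do ?case: ifP; lia.
Qed.

Lemma corner_inj j k : corner n.+1 h j -> corner n.+1 h k ->
  (hbar h j <= hbar h k)%N -> (k <= j)%N -> j = k.
Proof.
move=> [/andP[j1 jn] _ ltj] _ lehjk lekj; apply/eqP; rewrite eqn_leq lekj andbT leqNgt.
apply/negP => ltkj; have : (hbar h k <= hbar h j.-1)%N by apply: hbar_mono; lia.
lia.
Qed.

(** The least j with [p <= hbar h j] works: minimality provides the jump. *)
Lemma corner_exists p q : (1 <= p)%N -> (1 <= q <= n.+1)%N -> p != q -> (p <= h q)%N ->
  exists j, [/\ corner n.+1 h j, (p <= hbar h j)%N & (j <= q)%N].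
Proof.
move=> p1 q1n npq lepq; have [hb _] := hH.
(* Passing from [h] to [hbar] lowers the value only from q to q - 1, which p <= q and p != q
   absorb. *)
have lephq : (p <= hbar h q)%N by rewrite /hbar; case: eqP => [|_]; [lia | case: ifP; lia].
have ex : exists k, (p <= hbar h k)%N by exists q.
case: (ex_minnP ex) => j lepj jmin; have lejq := jmin _ lephq.
have j1 : (1 <= j)%N by case: j lepj {jmin lejq} => //; rewrite /hbar /=; lia.
exists j; split=> //; split; first lia.
  have := hb j; move: lepj; rewrite /hbar; case: eqP => _; first lia.
  by case: ifP; lia.
rewrite ltnNge; apply/negP => le; have := jmin j.-1 (leq_trans lepj le); lia.
Qed.

(** The predecessors convert to 0-based positions; by [corner_ord] the [inord] is faithful at
    corners. *)
Definition corner_constr (j : nat) : 'M[F]_n.+1 -> Prop :=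
  flag_constr (inord (hbar h j).-1) (inord j.-1).

Lemma corner_ord j : corner n.+1 h j ->
  [/\ (@inord n (hbar h j).-1).+1 = hbar h j, (@inord n j.-1).+1 = j &
      inord (hbar h j).-1 != inord j.-1 :> 'I_n.+1].
Proof.
move=> cj; have nj := corner_neq cj; have [/andP[j1 jn] /andP[h1 hn] _] := cj.
by rewrite -val_eqE /= !inordK; [split | |]; lia.
Qed.

Lemma hessX_corners g : (0 < n)%N ->
  hessX h g <-> exists2 j, corner n.+1 h j & corner_constr j g.
Proof.
move=> n_gt0; split=> [Xg|[j cj fg]].
  have [v cg] : exists v, bcell v g by apply: inSL_bcell; case: Xg.
  have /(hessX_bcell n_gt0 cg) lepq := Xg.
  set p := (v^-1)%g ord0 in lepq; set q := (v^-1)%g ord_max in lepq.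
  have npq : p != q by rewrite (inj_eq perm_inj) -val_eqE /=; lia.
  have [||j [cj lep leq]] := @corner_exists p.+1 q.+1 isT _ _ lepq.
  - by rewrite /= ltn_ord.
  - by rewrite eqSS.
  exists j => //; apply/(flag_constr_bcell _ _ cg).
  have [ea eb _] := corner_ord cj.
  by rewrite /pos_constr -/p -/q; lia.
have [v cg] : exists v, bcell v g by apply: inSL_bcell; case: fg.
apply/(hessX_bcell n_gt0 cg).
have /(flag_constr_bcell _ _ cg)[] := fg; have [ea eb _] := corner_ord cj.
set p := (v^-1)%g ord0; set q := (v^-1)%g ord_max => lepa lebq.
have [_ hm] := hH; have [/andP[j1 jn] _ _] := cj.
have := hm j q.+1 j1; have := ltn_ord q.
have : (hbar h j <= h j)%N.
  rewrite /hbar; case: eqP => [|_]; first lia.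
  by case: ifP; lia.
lia.
Qed.

End HessenbergVariety.

(** * Irreducible components and corners *)

Theorem mainTheorem15 (F : closedFieldType) (charF0 : [pchar F]%R =i pred0)
    (n : nat) (hn : (2 <= n)%N) (h : nat -> nat) (hH : hessenberg_fun n h)
    (w : nat -> 'S_n)
    (hw : forall j, corner n h j -> longest_with (hbar h j) j (w j)) :
  [/\ (forall j, corner n h j -> irr_component (@hessX F n h) (@schubert F n (w j))),
      (forall j j', corner n h j -> corner n h j' ->
          eqsetP (@schubert F n (w j)) (@schubert F n (w j')) -> j = j') &
      (forall Y, irr_component (@hessX F n h) Y ->
          exists j, corner n h j /\ eqsetP Y (@schubert F n (w j)))].
Proof.
case: n hn hH w hw => [//|n] n_gt0 hH w hw.
have lw j : corner n.+1 h j ->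
    longest_with (@inord n (hbar h j).-1).+1 (@inord n j.-1).+1 (w j).
  by move=> cj; have [-> -> _] := corner_ord hH cj; exact: hw.
have schubertE j : corner n.+1 h j -> eqsetP (@schubert F n.+1 (w j)) (@corner_constr F n h j).
  by move=> cj; apply: schubert_longest (lw j cj); have [] := corner_ord hH cj.
have constr_inj j k : corner n.+1 h j -> corner n.+1 h k ->
    Defs.subsetP (@corner_constr F n h j) (corner_constr h k) -> j = k.
  move=> cj ck; have [ja jb nab] := corner_ord hH cj; have [ka kb _] := corner_ord hH ck.
  move=> /(flag_constr_sub nab (ex_intro _ _ (lw j cj))) [le1 le2].
  by apply: (corner_inj hH cj ck); lia.
have schubert_sub j : corner n.+1 h j -> Defs.subsetP (@schubert F n.+1 (w j)) (hessX h).
  by move=> cj g /(schubertE j cj) cg; apply/(hessX_corners hH _ n_gt0); exists j.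
have schubert_GB (j : nat) : GBsubset (@schubert F n.+1 (w j)).
  exact/closureGB_GBsubset/bcell_GBsubset.
have sub_corner Y : irreducible Y -> Defs.subsetP Y (@hessX F n.+1 h) ->
    exists2 j, corner n.+1 h j & Defs.subsetP Y (@schubert F n.+1 (w j)).
  move=> irrY sY.
  (* Corners satisfy j <= n.+1, so [n.+2] bounds the finite union. *)
  have [|g /sY/(hessX_corners hH _ n_gt0)[j cj cg]|j cj sYj] :=
    @irreducible_sub_bigcup F n.+1 Y (corner n.+1 h) (@corner_constr F n h) n.+2 irrY.
  - by move=> k _; exact: flag_constr_closed.
  - by exists j; split=> //; case: cj => /andP[].
  by exists j => // g /sYj/(schubertE j cj).
split.
- move=> j cj; split=> //; [exact: schubert_sub | exact: irreducible_schubert |].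
  (* Maximality: a larger irreducible [Y] lies in the Schubert variety of some corner k, and the
     absence of inclusions between distinct corners forces k = j. *)
  move=> Y _ irrY sjY sYX; have [k ck sYk] := sub_corner Y irrY sYX.
  have jk : j = k.
    by apply: constr_inj => // g /(schubertE j cj)/sjY/sYk/(schubertE k ck).
  by move=> g; split; [rewrite jk; exact: sYk | exact: sjY].
- move=> j k cj ck eqjk; apply: constr_inj => // g /(schubertE j cj)/eqjk.
  by move/(schubertE k ck).
move=> Y [GBY sYX irrY maxY]; have [j cj sYj] := sub_corner Y irrY sYX.
exists j; split=> // g; have := maxY _ (schubert_GB j) (irreducible_schubert F (w j)) sYj.
by move=> /(_ (schubert_sub j cj) g) [].
Qed.
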